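(* Let $K$ be a field of characteristic $p>0$. Then $\mathrm{Dim}(M)\ge n$ for all nonzero finitely generated $\mathcal D(P_n)$-modules $M$.
   Context: $P_n=K[x_1,\dots,x_n]$, $n\ge1$; $\mathcal D(P_n)$ is the ring of $K$-linear differential operators on $P_n$. For $k\ge0$ let $\partial_i^{[k]}=\frac{\partial_i^k}{k!}$ be the $K$-linear operator $x^\alpha\mapsto\binom{\alpha_i}{k}x^{\alpha-ke_i}$ (zero if $k>\alpha_i$, where $e_i$ is the $i$-th unit vector), and $\partial^{[\beta]}=\prod_i\partial_i^{[\beta_i]}$ for $\beta\in\mathbb N^n$. Then $\mathcal D(P_n)=\bigoplus_{\alpha,\beta\in\mathbb N^n}Kx^\alpha\partial^{[\beta]}$. The canonical filtration is $F=\{F_i\}_{i\ge 0}$, $F_i=\bigoplus_{|\alpha|+|\beta|\le i}Kx^\alpha\partial^{[\beta]}$. Modules are left modules. For $f:\mathbb N\to\mathbb N$, $\gamma(f):=\inf\{r\ge0: f(i)\le i^r\text{ for }i\gg0\}$. For a finitely generated module $M=\mathcal D(P_n)M_0$ with $\dim_KM_0<\infty$, $\mathrm{Dim}(M):=\gamma(i\mapsto\dim_K F_iM_0)$; this is independent of $M_0$. *)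

(* Defs.v *)
From HB Require Import structures.
From mathcomp Require Import all_boot all_order all_algebra.
(* mpoly must be imported before mathcomp-analysis: in the other order their
   notation levels clash. *)
From mathcomp Require Import bigenough ssrcomplements mpoly.
From mathcomp Require Import all_classical all_reals all_analysis.
Set Implicit Arguments.
Unset Strict Implicit.
Unset Printing Implicit Defensive.
Import Order.TTheory GRing.Theory Num.Theory BigEnough.
Local Open Scope classical_set_scope.
Local Open Scope ring_scope.

Section Endomorphisms.
Variables (n : nat) (K : fieldType).

Definition endo := {linear {mpoly K[n]} -> {mpoly K[n]}}.

HB.instance Definition _ := gen_eqMixin endo.
HB.instance Definition _ := gen_choiceMixin endo.

Definition endo_app (u : endo) : {mpoly K[n]} -> {mpoly K[n]} := u.

Lemma endoP (u v : endo) : (forall f, endo_app u f = endo_app v f) -> u = v.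
Proof.
rewrite /endo_app; case: u v => [u [[hu0] [hu1]]] [v [[hv0] [hv1]]] /= /funext e.
case: _ / e in hv0 hv1 *.
by rewrite (Prop_irrelevance hu0 hv0) (Prop_irrelevance hu1 hv1).
Qed.

Definition endo_of (g : {mpoly K[n]} -> {mpoly K[n]}) (g_lin : linear g) : endo :=
  HB.pack g (GRing.isLinear.Build _ _ _ _ g g_lin).

Lemma endo_ofE g g_lin : endo_app (@endo_of g g_lin) = g. Proof. by []. Qed.

Lemma endo_linear (u : endo) : linear (endo_app u).
Proof. by move=> c f g; rewrite /endo_app linearP. Qed.

Lemma zero_lin : linear (fun f : {mpoly K[n]} => 0 : {mpoly K[n]}).
Proof. by move=> c f g; rewrite scaler0 addr0. Qed.
Lemma id_lin : linear (fun f : {mpoly K[n]} => f).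
Proof. by []. Qed.
Lemma opp_lin (u : endo) : linear (fun f => - endo_app u f).
Proof. by move=> c f g; rewrite endo_linear opprD scalerN. Qed.
Lemma add_lin (u v : endo) : linear (fun f => endo_app u f + endo_app v f).
Proof. by move=> c f g; rewrite !endo_linear scalerDr addrACA. Qed.
Lemma comp_lin (u v : endo) : linear (fun f => endo_app u (endo_app v f)).
Proof. by move=> c f g; rewrite !endo_linear. Qed.
Lemma scale_lin (a : K) (u : endo) : linear (fun f => a *: endo_app u f).
Proof.
by move=> c f g; rewrite endo_linear scalerDr !scalerA [a * c]mulrC.
Qed.

Let add u v := endo_of (add_lin u v).
Let opp u := endo_of (opp_lin u).
Let mul u v := endo_of (comp_lin u v).
Let scale a u := endo_of (scale_lin a u).

Lemma endo_addA : associative add.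
Proof. by move=> u v w; apply/endoP => f; rewrite !endo_ofE addrA. Qed.
Lemma endo_addC : commutative add.
Proof. by move=> u v; apply/endoP => f; rewrite !endo_ofE addrC. Qed.
Lemma endo_add0 : left_id (endo_of zero_lin) add.
Proof. by move=> u; apply/endoP => f; rewrite !endo_ofE add0r. Qed.
Lemma endo_addN : left_inverse (endo_of zero_lin) opp add.
Proof. by move=> u; apply/endoP => f; rewrite !endo_ofE addNr. Qed.
HB.instance Definition _ :=
  GRing.isZmodule.Build endo endo_addA endo_addC endo_add0 endo_addN.

Lemma endo_mulA : associative mul.
Proof. by move=> u v w; apply/endoP => f; rewrite !endo_ofE. Qed.
Lemma endo_mul1 : left_id (endo_of id_lin) mul.
Proof. by move=> u; apply/endoP => f; rewrite !endo_ofE. Qed.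
Lemma endo_mulr1 : right_id (endo_of id_lin) mul.
Proof. by move=> u; apply/endoP => f; rewrite !endo_ofE. Qed.
Lemma endo_mulDl : left_distributive mul +%R.
Proof. by move=> u v w; apply/endoP => f; rewrite !endo_ofE. Qed.
Lemma endo_mulDr : right_distributive mul +%R.
Proof.
move=> u v w; apply/endoP => f; rewrite !endo_ofE.
by rewrite /endo_app /= raddfD.
Qed.
Lemma endo_1neq0 : endo_of id_lin != 0.
Proof.
apply/eqP => /(congr1 (fun u => endo_app u 1)); rewrite !endo_ofE => /eqP.
by rewrite oner_eq0.
Qed.
HB.instance Definition _ := GRing.Zmodule_isNzRing.Build endo
  endo_mulA endo_mul1 endo_mulr1 endo_mulDl endo_mulDr endo_1neq0.

Lemma endo_scaleA a b u : scale a (scale b u) = scale (a * b) u.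
Proof. by apply/endoP => f; rewrite !endo_ofE scalerA. Qed.
Lemma endo_scale1 : left_id 1 scale.
Proof. by move=> u; apply/endoP => f; rewrite !endo_ofE scale1r. Qed.
Lemma endo_scaleDr : right_distributive scale +%R.
Proof. by move=> a u v; apply/endoP => f; rewrite !endo_ofE scalerDr. Qed.
Lemma endo_scaleDl u : {morph scale^~ u : a b / a + b}.
Proof. by move=> a b; apply/endoP => f; rewrite !endo_ofE scalerDl. Qed.
HB.instance Definition _ := GRing.Zmodule_isLmodule.Build K endo
  endo_scaleA endo_scale1 endo_scaleDr endo_scaleDl.

Lemma endo_scaleAl (a : K) (u v : endo) : a *: (u * v) = a *: u * v.
Proof. by apply/endoP. Qed.
HB.instance Definition _ := GRing.Lmodule_isLalgebra.Build K endo endo_scaleAl.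

Lemma endo_scaleAr (a : K) (u v : endo) : a *: (u * v) = u * (a *: v).
Proof. by apply/endoP => f; rewrite !endo_ofE /endo_app linearZ. Qed.
HB.instance Definition _ := GRing.Lalgebra_isAlgebra.Build K endo endo_scaleAr.

End Endomorphisms.

Section DiffOp.
Variables (n : nat) (K : fieldType).
Local Notation P := {mpoly K[n]}.
Local Notation E := (endo n K).

Lemma mulop_lin (r : P) : linear (fun f : P => r * f).
Proof. by move=> c f g; rewrite mulrDr -scalerAr. Qed.
Definition mulop (r : P) : E := endo_of (mulop_lin r).

(* [diffop_lt k u] says that [u] has order < k, so [diffop_lt 0] is the zero
   space: u has order <= k iff all the commutators [r, u], r in P_n, have
   order <= k - 1. *)
Fixpoint diffop_lt (k : nat) (u : E) : Prop :=
  if k is k'.+1 then forall r : P, diffop_lt k' (mulop r * u - u * mulop r)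
  else u = 0.

Definition is_diffop (u : E) : bool := `[< exists k, diffop_lt k u >].

Lemma mulopM r s : mulop (r * s) = mulop r * mulop s.
Proof. by apply/endoP => f; rewrite !endo_ofE mulrA. Qed.
Lemma mulopC r s : mulop r * mulop s = mulop s * mulop r.
Proof. by rewrite -!mulopM mulrC. Qed.
Lemma mulopP c r s : mulop (c *: r + s) = c *: mulop r + mulop s.
Proof. by apply/endoP => f; rewrite !endo_ofE mulrDl scalerAl. Qed.
Lemma mulop0 : mulop 0 = 0.
Proof. by apply/endoP => f; rewrite !endo_ofE mul0r. Qed.
Lemma mulop1 : mulop 1 = 1.
Proof. by apply/endoP => f; rewrite !endo_ofE mul1r. Qed.

Lemma diffop_lt0 k : diffop_lt k 0.
Proof. by elim: k => //= k IHk r; rewrite mulr0 mul0r subrr. Qed.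

Lemma diffop_ltS k u : diffop_lt k u -> diffop_lt k.+1 u.
Proof.
elim: k u => [|k IHk] u; first by move=> /= -> r; rewrite mulr0 mul0r subrr.
by move=> hu r; apply/IHk/hu.
Qed.

Lemma diffop_lt_leq k l u : (k <= l)%N -> diffop_lt k u -> diffop_lt l u.
Proof.
move=> /subnKC <-; elim: (l - k)%N => [|d IHd] hu; first by rewrite addn0.
by rewrite addnS; apply/diffop_ltS/IHd.
Qed.

Lemma diffop_ltP k c u v :
  diffop_lt k u -> diffop_lt k v -> diffop_lt k (c *: u + v).
Proof.
elim: k u v => [|k IHk] u v; first by move=> /= -> ->; rewrite scaler0 addr0.
move=> hu hv r; rewrite mulrDr mulrDl opprD addrACA -scalerAr -scalerAl.
by rewrite -scalerBr; apply: IHk.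
Qed.

Lemma diffop_ltM k l u v :
  diffop_lt k u -> diffop_lt l v -> diffop_lt (k + l) (u * v).
Proof.
elim: k u l v => [|k IHk] u l v hu hv.
  by rewrite (_ : u = 0) // mul0r; apply: diffop_lt0.
elim: l v hv => [|l IHl] v hv.
  by rewrite (_ : v = 0) // mulr0; apply: diffop_lt0.
move=> r; rewrite (_ : _ - _ = (mulop r * u - u * mulop r) * v +
    u * (mulop r * v - v * mulop r)); last first.
  by rewrite mulrBl mulrBr !mulrA [RHS]addrA subrK.
rewrite -[X in X + _]scale1r; apply: diffop_ltP.
  exact: IHk (hu r) hv.
by rewrite -addSnnS; apply: IHl; apply: hv.
Qed.

Lemma diffop_lt_mull k s u : diffop_lt k u -> diffop_lt k (mulop s * u).
Proof.
elim: k u => [|k IHk] u hu; first by rewrite (_ : u = 0) // mulr0.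
by move=> r; rewrite mulrA mulopC -!mulrA -mulrBr; apply/IHk/hu.
Qed.

Lemma diffop_lt_mulr k s u : diffop_lt k u -> diffop_lt k (u * mulop s).
Proof.
elim: k u => [|k IHk] u hu; first by rewrite (_ : u = 0) // mul0r.
by move=> r; rewrite -mulrA -[mulop s * _]mulopC !mulrA -mulrBl; apply/IHk/hu.
Qed.

Lemma is_diffop_mulop r : is_diffop (mulop r).
Proof. by apply/asboolP; exists 1%N => s /=; rewrite mulopC subrr. Qed.

Lemma is_diffop_subalg : GRing.subalg_closed is_diffop.
Proof.
split.
- by rewrite -mulop1; exact: is_diffop_mulop.
- move=> c u v /asboolP[k hu] /asboolP[l hv]; apply/asboolP; exists (k + l)%N.
  by apply: diffop_ltP;
    [apply: diffop_lt_leq hu; apply: leq_addr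
    |apply: diffop_lt_leq hv; apply: leq_addl].
- move=> u v /asboolP[k hu] /asboolP[l hv]; apply/asboolP.
  by exists (k + l)%N; apply: diffop_ltM.
Qed.
HB.instance Definition _ := GRing.isSubalgClosed.Build K E is_diffop
  (GRing.subalg_closed_semi is_diffop_subalg).

(* The ring D(P_n) of K-linear differential operators on P_n. *)
Record diffop := DiffOp { diffop_val : E; diffop_valP : is_diffop diffop_val }.
HB.instance Definition _ := [isSub for diffop_val].
HB.instance Definition _ := [Choice of diffop by <:].
HB.instance Definition _ := [SubChoice_isSubAlgebra of diffop by <:].

(* The truncated subtraction in the exponent is harmless: the binomial
   coefficient vanishes when m i < k. *)
Definition divdiff_fun (i : 'I_n) (k : nat) (f : P) : P :=
  \sum_(m <- msupp f) (f@_m *+ 'C(m i, k)) *: 'X_[m - U_(i) *+ k].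

Lemma divdiff_funwE i k f b : (msize f <= b)%N ->
  divdiff_fun i k f = \sum_(m : 'X_{1..n < b})
    (f@_m *+ 'C((m : 'X_{1..n}) i, k)) *: 'X_[m - U_(i) *+ k].
Proof.
pose I : subFinType _ := 'X_{1..n < b}.
move=> le_fb; rewrite /divdiff_fun (big_mksub I) /=; first last.
  by move=> x /msize_mdeg_lt/leq_trans/(_ le_fb).
  by rewrite msupp_uniq.
rewrite big_rmcond //= => j /memN_msupp_eq0 ->.
by rewrite mul0rn scale0r.
Qed.

Lemma divdiff_lin i k : linear (divdiff_fun i k).
Proof.
move=> c f g; pose_big_enough b; first rewrite !(@divdiff_funwE _ _ _ b) //.
  rewrite scaler_sumr -big_split /=; apply/eq_bigr=> m _.
  by rewrite scalerA -scalerDl mcoeffD mcoeffZ mulrnDl mulrnAr.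
by close.
Qed.
Definition divdiff i k : E := endo_of (@divdiff_lin i k).

Lemma divdiffX i k m :
  endo_app (divdiff i k) 'X_[m] = 'C(m i, k)%:R *: 'X_[m - U_(i) *+ k].
Proof. by rewrite endo_ofE /divdiff_fun msuppX big_seq1 mcoeffX eqxx. Qed.

Lemma endoXP (u v : E) :
  (forall m, endo_app u 'X_[m] = endo_app v 'X_[m]) -> u = v.
Proof.
move=> h; apply/endoP => f; rewrite [f]mpolyE /endo_app !linear_sum /=.
by apply: eq_bigr => m _; rewrite !linearZ /=; congr (_ *: _); apply: h.
Qed.

Lemma divdiff0 i : divdiff i 0 = 1.
Proof.
by apply/endoXP => m; rewrite divdiffX bin0 scale1r mulm0n subm0.
Qed.

Lemma comm_divdiffX i k (j : 'I_n) :
  mulop 'X_j * divdiff i k.+1 - divdiff i k.+1 * mulop 'X_j =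
  - (i == j)%:R *: divdiff i k.
Proof.
apply/endoXP => m.
have -> : endo_app (mulop 'X_j * divdiff i k.+1 - divdiff i k.+1 * mulop 'X_j)
    'X_[m] = 'X_j * endo_app (divdiff i k.+1) 'X_[m] -
             endo_app (divdiff i k.+1) ('X_j * 'X_[m]) by [].
have -> : endo_app (- (i == j)%:R *: divdiff i k) 'X_[m] =
  - (i == j)%:R *: endo_app (divdiff i k) 'X_[m] by [].
rewrite -mpolyXD !divdiffX mnmDE mnm1E eq_sym -scalerAr -mpolyXD.
have [<-|ne_ij] := eqVneq i j; last first.
  rewrite add0n oppr0 scale0r; have [lt|ge] := ltnP (m i) k.+1.
    by rewrite bin_small // !scale0r subrr.
  suff -> : (U_(j) + (m - U_(i) *+ k.+1) = U_(j) + m - U_(i) *+ k.+1)%MM.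
    by rewrite subrr.
  apply/mnmP => l; rewrite !(mnmDE, mnmBE, mulmnE, mnm1E) addnBA //.
  by case: eqVneq => [<-|]; rewrite ?mul1n ?mul0n.
rewrite add1n binS scaleN1r natrD scalerDl opprD addrA.
have [lt|ge] := ltnP (m i) k.
  by rewrite (bin_small lt) (bin_small (ltnW lt : (m i < k.+1)%N)) !scale0r
    !subr0 oppr0.
have [lt|ge'] := ltnP (m i) k.+1.
  rewrite (bin_small lt) !scale0r subrr sub0r.
  congr (- (_ *: 'X_[_])); apply/mnmP => l.
  rewrite !(mnmDE, mnmBE, mulmnE, mnm1E).
  by case: eqVneq => [_|_]; rewrite ?mul1n ?mul0n.
have e : (U_(i) + (m - U_(i) *+ k.+1) = U_(i) + m - U_(i) *+ k.+1)%MM.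
  apply/mnmP => l; rewrite !(mnmDE, mnmBE, mulmnE, mnm1E) addnBA //.
  by case: eqVneq => [<-|]; rewrite ?mul1n ?mul0n.
rewrite e subrr sub0r; congr (- (_ *: 'X_[_])); apply/mnmP => l.
rewrite !(mnmDE, mnmBE, mulmnE, mnm1E).
by case: eqVneq => [_|_]; rewrite ?mul1n ?mul0n.
Qed.

Lemma diffop_lt_gen k u :
  (forall j : 'I_n, diffop_lt k (mulop 'X_j * u - u * mulop 'X_j)) ->
  diffop_lt k.+1 u.
Proof.
move=> hX.
pose C r := diffop_lt k (mulop r * u - u * mulop r).
have CP c r s : C r -> C s -> C (c *: r + s).
  move=> hr hs; rewrite /C mulopP mulrDl mulrDr opprD addrACA.
  by rewrite -scalerAl -scalerAr -scalerBr; apply: diffop_ltP.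
have C1 : C 1 by rewrite /C mulop1 mul1r mulr1 subrr; exact: diffop_lt0.
have CM r s : C r -> C s -> C (r * s).
  move=> hr hs; rewrite /C mulopM (_ : _ - _ =
    mulop r * (mulop s * u - u * mulop s) +
    (mulop r * u - u * mulop r) * mulop s); last first.
    by rewrite mulrBl mulrBr !mulrA [RHS]addrA subrK.
  rewrite -[X in X + _]scale1r; apply: diffop_ltP.
    exact: diffop_lt_mull.
  exact: diffop_lt_mulr.
elim/mpolyind => [|c m f _ _ hf].
  by rewrite mulop0 mulr0 mul0r subrr; exact: diffop_lt0.
apply: CP hf; rewrite mpolyXE_id.
elim/big_rec: _ => // j r _ hr; apply: (CM) => //.
by elim: (m j) => // l hl; rewrite exprS; apply: (CM) => //; apply: hX.
Qed.

Lemma diffop_lt_divdiff i k : diffop_lt k.+1 (divdiff i k).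
Proof.
elim: k => [|k IHk].
  by move=> r /=; rewrite divdiff0 mulr1 mul1r subrr.
apply: diffop_lt_gen => j; rewrite comm_divdiffX -[X in diffop_lt _ X]addr0.
by apply: diffop_ltP => //; exact: diffop_lt0.
Qed.

Lemma is_diffop_divdiff i k : is_diffop (divdiff i k).
Proof. by apply/asboolP; exists k.+1; exact: diffop_lt_divdiff. Qed.

(* x^a, for a in N^n, and the divided power derivation of order k in x_i. *)
Definition Dx (a : 'X_{1..n}) : diffop := DiffOp (is_diffop_mulop 'X_[a]).
Definition Ddiv (i : 'I_n) (k : nat) : diffop := DiffOp (is_diffop_divdiff i k).
Definition Ddivm (b : 'X_{1..n}) : diffop := \prod_(i < n) Ddiv i (b i).

End DiffOp.

Arguments Dx {n} K a.
Arguments Ddivm {n} K b.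

Section LinearAlgebra.
Variables (K : fieldType) (V : lmodType K).

Definition lspan (S : set V) : set V :=
  [set v | exists s : seq (K * V),
     (forall x, x \in s -> S x.2) /\ v = \sum_(x <- s) x.1 *: x.2].

Definition fin_dim (W : set V) : Prop := exists s : seq V, W = lspan [set` s].

Definition is_basis (W : set V) (d : nat) (v : 'I_d -> V) : Prop :=
  (forall c : 'I_d -> K, \sum_(i < d) c i *: v i = 0 -> forall i, c i = 0) /\
  W = lspan (range v).

(* The number of elements of a basis of W; the default value 0 is only reached
   when W is not a finite-dimensional subspace. *)
Definition ldim (W : set V) : nat :=
  xget 0%N [set d | exists v : 'I_d -> V, is_basis W v].

End LinearAlgebra.

(* A module over a K-algebra, seen as a vector space over K. *)
Definition restrict_scalars (K : fieldType) (A : algType K) (M : lmodType A)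
  : Type := M.

Section RestrictScalars.
Variables (K : fieldType) (A : algType K) (M : lmodType A).
Local Notation MK := (restrict_scalars M).

HB.instance Definition _ := GRing.Zmodule.on MK.

Let rscale (c : K) (m : MK) : MK := (c%:A : A) *: (m : M).

Lemma rscaleA a b m : rscale a (rscale b m) = rscale (a * b) m.
Proof. by rewrite /rscale scalerA -scalerAl mul1r scalerA. Qed.
Lemma rscale1 : left_id 1 rscale.
Proof. by move=> m; rewrite /rscale !scale1r. Qed.
Lemma rscaleDr : right_distributive rscale +%R.
Proof. by move=> a u v; rewrite /rscale scalerDr. Qed.
Lemma rscaleDl m : {morph rscale^~ m : a b / a + b}.
Proof. by move=> a b; rewrite /rscale !scalerDl. Qed.
HB.instance Definition _ :=
  GRing.Zmodule_isLmodule.Build K MK rscaleA rscale1 rscaleDr rscaleDl.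

(* The additive subgroup B C of M, made of the finite sums of products b c. *)
Definition smul (B : set A) (C : set MK) : set MK :=
  [set m | exists s : seq (A * M),
     (forall x, x \in s -> B x.1 /\ C x.2) /\ m = \sum_(x <- s) x.1 *: x.2].

Definition finitely_generated : Prop :=
  exists s : seq M, smul setT [set` s] = setT.

End RestrictScalars.

Section Dimension.
Variable R : realType.

(* gamma(f) = inf {r >= 0 : f(i) <= i^r for i >> 0}, which is +oo when no such
   r exists. *)
Definition gamma (f : nat -> nat) : \bar R :=
  ereal_inf [set r%:E | r in
    [set r : R | 0 <= r /\ \forall i \near \oo, (f i)%:R <= i%:R `^ r]].

Variables (n : nat) (K : fieldType).

Definition canonical_filtration (i : nat) : set (diffop n K) :=
  lspan [set u | exists a b : 'X_{1..n},
    (mdeg a + mdeg b <= i)%N /\ u = Dx K a * Ddivm K b].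

(* d is the value of Dim(M) computed from some finite-dimensional subspace M0
   that generates M; Dim(M) does not depend on the choice of M0, so this
   relation is the graph of Dim. *)
Definition is_Dim (M : lmodType (diffop n K)) (d : \bar R) : Prop :=
  exists M0 : set (restrict_scalars M),
    [/\ fin_dim M0, smul setT M0 = setT &
        d = gamma (fun i => ldim (smul (canonical_filtration i) M0))].

End Dimension.

Lemma is_Dim_ex (R : realType) (n : nat) (K : fieldType)
    (M : lmodType (diffop n K)) :
  finitely_generated M -> exists d : \bar R, is_Dim M d.
Proof.
move=> [s hs]; pose M0 := lspan [set` (s : seq (restrict_scalars M))].
exists (gamma R (fun i => ldim (smul (canonical_filtration i) M0))), M0.
split=> //; first by exists s.
rewrite -subTset => m; rewrite -hs => -[t [ht ->]]; exists t.
split=> // x /ht[_ xs]; split=> //; exists [:: (1, x.2)].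
by split=> [y|]; [rewrite inE => /eqP -> | rewrite big_seq1 scale1r].
Qed.

(* Main.v *)
(* Put q = p^k and let D be the product of the divided powers of order q - 1 in
   all the variables. Since C(m, q - 1) is 1 or 0 in K according to whether q
   divides m + 1, the operators x^a D x^(q-1-b), with exponents in [0, q), are
   the matrix units of a copy of the algebra of matrices of size q^n over K.
   If v is a nonzero element of M_0, then some u = D x^c v is nonzero, and the
   q^n elements x^b u are linearly independent; they lie in F_(3nq) M_0.
   Hence dim F_(3nq) M_0 >= q^n for all k, so that a bound
   dim F_i M_0 <= i^r forces q^n <= (3nq)^r for q large, i.e. r >= n. *)
Require Import Defs.
From HB Require Import structures.
From mathcomp Require Import all_boot all_order all_algebra.
From mathcomp Require Import mpoly.
From mathcomp Require Import zify.
From mathcomp Require Import all_classical all_reals all_analysis.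
Set Implicit Arguments.
Unset Strict Implicit.
Unset Printing Implicit Defensive.
Import Order.TTheory GRing.Theory Num.Theory.
Local Open Scope ring_scope.

(** * Bases of finite-dimensional subspaces and lower bounds for [ldim] *)

Section LinearAlgebra.
Variables (K : fieldType) (V : lmodType K).

Lemma lspan_range (I : finType) (w : I -> V) v :
  lspan (range w) v <-> exists c : I -> K, v = \sum_i c i *: w i.
Proof.
split=> [[s [hs ->]]|[c ->]].
  elim: s hs => [|x s IHs] hs.
    by exists (fun=> 0); rewrite big_nil big1 // => i _; rewrite scale0r.
  have [c e] := IHs (fun y ys => hs y (@mem_behead _ (x :: s) y ys)).
  have [i _ xi] := hs x (mem_head _ _).
  exists (fun j => (if j == i then x.1 else 0) + c j); rewrite big_cons e -xi.
  under [RHS]eq_bigr do rewrite scalerDl.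
  rewrite big_split /=; congr (_ + _).
  by rewrite (bigD1 i) //= eqxx big1 ?addr0 // => j /negPf ->; rewrite scale0r.
exists [seq (c i, w i) | i <- index_enum I]; split.
  by move=> _ /mapP[i _ ->]; exists i.
by rewrite big_map.
Qed.

Lemma lspan_seq (s : seq V) :
  lspan [set` s] = lspan (range (tnth (in_tuple s))).
Proof.
congr lspan; apply/seteqP; split=> [v /= /seq_tnthP[i ->]|_ [i _ <-]].
  by exists i.
exact: mem_tnth.
Qed.

(** A spanning family of minimal size is free: a nontrivial relation would express one vector
    through the others, and that vector could be dropped. *)
Lemma fin_dim_basis (W : set V) :
  fin_dim W -> exists d (v : 'I_d -> V), is_basis W v.
Proof.
move=> [s es]; pose P d := `[< exists v : 'I_d -> V, W = lspan (range v) >].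
have exP : exists d, P d.
  exists (size s); apply/asboolP; exists (tnth (in_tuple s)).
  by rewrite es lspan_seq.
case: (ex_minnP exP) => d /asboolP[v ev] dmin; exists d, v; split=> // c c0 i.
apply/eqP/negPn/negP => ci0.
case: d => [|d] in v ev dmin c i c0 ci0 *; first by case: i ci0.
suff /dmin : P d by rewrite ltnn.
apply/asboolP; exists (v \o lift i); rewrite ev.
have vi : v i = \sum_j (- (c i)^-1 * c (lift i j)) *: v (lift i j).
  move: c0; rewrite (bigD1_ord i) //= => /eqP; rewrite addr_eq0 => /eqP e.
  have := congr1 (fun x => (c i)^-1 *: x) e; rewrite scalerA mulVf // scale1r.
  move=> ->; rewrite scalerN scaler_sumr -sumrN; apply: eq_bigr => j _.
  by rewrite scalerA mulNr scaleNr.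
apply/seteqP; split=> x /lspan_range[a ->]; apply/lspan_range.
  exists (fun j => a i * (- (c i)^-1 * c (lift i j)) + a (lift i j)).
  rewrite (bigD1_ord i) //= [in LHS]vi scaler_sumr -big_split /=.
  by apply: eq_bigr => j _; rewrite scalerDl scalerA.
exists (fun j => if unlift i j is Some j' then a j' else 0).
rewrite (bigD1_ord i) //= unlift_none scale0r add0r.
by apply: eq_bigr => j _; rewrite liftK.
Qed.

(** [fin_dim W] guarantees that [ldim W] is the size of an actual basis and not the default value 0.
    The rest is the exchange argument in matrix form. *)
Lemma card_free_le_ldim (W : set V) (I : finType) (w : I -> V) :
    fin_dim W -> (forall i, W (w i)) ->
    (forall c : I -> K, \sum_i c i *: w i = 0 -> forall i, c i = 0) ->
  (#|I| <= ldim W)%N.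
Proof.
move=> /fin_dim_basis[d0 basisW] wW w_free; rewrite /ldim.
pose has_basis d := exists v : 'I_d -> V, is_basis W v.
have [v [_ eW]] := xgetPex 0%N (ex_intro has_basis d0 basisW).
move: (xget _ _) v eW => d v eW; rewrite leqNgt; apply/negP => ltdI.
have /choice[a ea] : forall i, exists c : 'I_d -> K, w i = \sum_j c j *: v j.
  by move=> i; apply/lspan_range; rewrite -eW.
pose A := \matrix_(i < #|I|, j < d) a (enum_val i) j.
(* With more vectors than basis elements, the coordinate matrix has more rows than columns. Yet each
   row of its left kernel is a relation between the [w i], hence zero. *)
have : kermx A != 0.
  by rewrite kermx_eq0 /row_free neq_ltn (leq_ltn_trans (rank_leq_col A)).
apply/negP/negPn/eqP/row_matrixP => k; rewrite row0.
set u := row k (kermx A).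
have uA : u *m A = 0 by rewrite -row_mul mulmx_ker row0.
move: u uA => {k} u uA; have u0 := w_free (fun i => u 0 (enum_rank i)).
apply/rowP => i; rewrite [RHS]mxE -[i]enum_valK; apply: u0.
under eq_bigr => j _ do rewrite ea scaler_sumr.
rewrite exchange_big /= big1 // => j _.
under eq_bigr => i' _ do rewrite scalerA.
have e : \sum_i' u 0 (enum_rank i') * a i' j = (u *m A) 0 j.
  rewrite mxE (reindex (fun l : 'I_#|I| => enum_val l)) /=.
    by apply: eq_bigr => l _; rewrite mxE enum_valK.
  exact/onW_bij/enum_val_bij.
by rewrite -scaler_suml e uA mxE scale0r.
Qed.

End LinearAlgebra.

(** * Binomial coefficients modulo p *)

Section Binomials.
Variables (K : fieldType) (p : nat).
Hypothesis pK : p \in [pchar K].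

(** Put q = p^k. By Frobenius, (X + 1)^(m + q) = (X + 1)^m (X^q + 1), and the summand with the
    factor X^q does not reach the coefficient of X^j when j < q. *)
Lemma bin_addn_pchar k m j : (j < p ^ k)%N ->
  'C(m + p ^ k, j)%:R = 'C(m, j)%:R :> K.
Proof.
move=> jq; have coef_binom i : ((('X + 1) ^+ i : {poly K})`_j = 'C(i, j)%:R).
  rewrite exprD1n coef_sum; under eq_bigr => l _ do rewrite coefMn coefXn.
  have [ji|ij] := ltnP i j.
    rewrite bin_small // big1 // => l _.
    by rewrite gtn_eqF ?mul0rn // (leq_trans (ltn_ord l)).
  rewrite (bigD1 (Ordinal (ij : (j < i.+1)%N))) //= eqxx big1 ?addr0 //.
  move=> l /eqP nl; case: eqP => [e|_]; rewrite ?mul0rn //.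
  by case: nl; apply: val_inj.
have chP : p \in [pchar {poly K}] by rewrite pchar_poly.
rewrite -!coef_binom exprD (_ : ('X + 1) ^+ (p ^ k) = 'X ^+ (p ^ k) + 1).
  by rewrite mulrDr mulr1 coefD coefMXn jq add0r.
by rewrite exprDn_pchar ?expr1n // pnatX (pnatE _ (pcharf_prime pK)) chP.
Qed.

(** Both sides have period p^k in m, which leaves m < p^k; there only m = p^k - 1 gives a nonzero
    value. *)
Lemma bin_predn_pchar k m :
  'C(m, (p ^ k).-1)%:R = (p ^ k %| m.+1)%:R :> K.
Proof.
have q_gt0 : (0 < p ^ k)%N by rewrite expn_gt0 prime_gt0 // (pcharf_prime pK).
have ltq : ((p ^ k).-1 < p ^ k)%N by rewrite prednK.
elim/ltn_ind: m => m IHm; have [lt_m|le_q] := ltnP m (p ^ k); last first.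
  rewrite -(subnK le_q) bin_addn_pchar // IHm.
    by rewrite -addSn dvdn_addl.
  by rewrite ltn_subrL q_gt0 (leq_trans q_gt0).
have [->|ne_m] := eqVneq m (p ^ k).-1; first by rewrite binn prednK // dvdnn.
have lt_mq : (m < (p ^ k).-1)%N by rewrite ltn_neqAle ne_m -ltnS prednK.
by rewrite bin_small ?gtnNdvd // -(prednK q_gt0).
Qed.

End Binomials.

(** * Action on monomials and commutation with the variables *)

Section Action.
Variables (n : nat) (K : fieldType).
Implicit Types (u v : diffop n K) (a b m : 'X_{1..n}).

Local Notation app u := (endo_app (diffop_val u)).

Lemma diffopXP u v : (forall m, app u 'X_[m] = app v 'X_[m]) -> u = v.
Proof. by move=> uv; apply/val_inj/endoXP. Qed.

Lemma app_Dx a m : app (Dx K a) 'X_[m] = 'X_[a + m].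
Proof. by rewrite mpolyXD. Qed.

Lemma appM u v f : app (u * v) f = app u (app v f). Proof. by []. Qed.

Lemma appD u v f : app (u + v) f = app u f + app v f. Proof. by []. Qed.

Lemma appZ u c f : app u (c *: f) = c *: app u f.
Proof. by rewrite /endo_app linearZ. Qed.

Lemma app_sum (I : finType) (u : I -> diffop n K) f :
  app (\sum_i u i) f = \sum_i app (u i) f.
Proof. exact: (big_morph (fun u => app u f) (fun u v => erefl) erefl). Qed.

Lemma DxD a b : Dx K (a + b) = Dx K a * Dx K b.
Proof. by apply: diffopXP => m; rewrite appM !app_Dx addmA. Qed.

Lemma Dx0 : Dx K (0%MM : 'X_{1..n}) = 1.
Proof. by apply: diffopXP => m; rewrite app_Dx add0m. Qed.

Lemma app_Ddivm b m :
  app (Ddivm K b) 'X_[m] = (\prod_i 'C(m i, b i))%:R *: 'X_[m - b].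
Proof.
(* Each factor changes only the exponent of its own variable. Uniqueness ensures that the exponent
   of [i] is still [m i] when the factor of index [i] acts. *)
have main (r : seq 'I_n) : uniq r ->
    app (\prod_(i <- r) Ddiv K i (b i)) 'X_[m] =
    (\prod_(i <- r) 'C(m i, b i))%:R *: 'X_[m - \sum_(i <- r) U_(i) *+ b i].
  elim: r => [|i r IHr]; first by rewrite !big_nil scale1r subm0.
  rewrite !big_cons cons_uniq => /andP[i_r /IHr{}IHr].
  rewrite appM IHr appZ [app (Ddiv K i (b i)) _]divdiffX.
  rewrite scalerA natrM mulrC submDA addmC -submDA.
  congr ('C(_, _)%:R * _ *: 'X_[_]).
  rewrite mnmBE mnm_sumE big1_seq ?subn0 // => j /andP[_ jr].
  by rewrite mulmnE mnm1E; case: eqVneq jr i_r => [->->|_]; rewrite ?mul0n.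
by have := main _ (index_enum_uniq 'I_n); rewrite -(multinomUE_id b).
Qed.

(** This is Pascal's rule in the variable [j]. The case [b j = 0] is separate because the truncated
    [b - U_(j)] would then be [b], whereas the commutator is 0. *)
Lemma Ddivm_mulX b (j : 'I_n) :
  Ddivm K b * Dx K U_(j) = Dx K U_(j) * Ddivm K b +
    (if b j == 0%N then 0 else Ddivm K (b - U_(j))).
Proof.
have expE m : (b j <= m j)%N -> (U_(j) + (m - b) = U_(j) + m - b)%MM.
  move=> bm; apply/mnmP => i; rewrite !(mnmDE, mnmBE, mnm1E).
  by case: eqVneq bm => [<-|_] bm; lia.
apply: diffopXP => m; rewrite appM app_Dx app_Ddivm.
rewrite appD appM app_Ddivm appZ app_Dx.
have off : (\prod_(i | i != j) 'C((U_(j) + m)%MM i, b i) =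
   \prod_(i | i != j) 'C(m i, b i))%N.
  by apply: eq_bigr => i /negPf ij; rewrite mnmDE mnm1E eq_sym ij.
case: eqVneq => [bj0|bj_neq0].
  rewrite expE ?bj0 // addr0; congr (_%:R *: _).
  apply: eq_bigr => i _; rewrite mnmDE mnm1E.
  by case: eqVneq => [<-|_]; rewrite ?bj0 ?bin0.
rewrite app_Ddivm (_ : m - (b - U_(j)) = U_(j) + m - b)%MM; last first.
  apply/mnmP => i; rewrite !(mnmDE, mnmBE, mnm1E).
  by case: eqVneq => [<-|_]; [lia|rewrite subn0].
rewrite !(bigD1 (P := xpredT) j) //= off.
have -> : (\prod_(i | i != j) 'C(m i, (b - U_(j))%MM i) =
    \prod_(i | i != j) 'C(m i, b i))%N.
  by apply: eq_bigr => i /negPf ij; rewrite mnmBE mnm1E eq_sym ij subn0.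
rewrite mnmDE mnmBE mnm1E eqxx subn1 add1n.
have -> : 'C((m j).+1, b j) = ('C(m j, b j) + 'C(m j, (b j).-1))%N.
  by case: (b j) bj_neq0 => // k _; rewrite binS.
have [bm|mb] := leqP (b j) (m j).
  by rewrite expE // -scalerDl -natrD mulnDl.
by rewrite (bin_small mb) !mul0n scale0r add0r add0n.
Qed.

Lemma appZ0 u : app u 0 = 0.
Proof. by have := appZ u 0 0; rewrite !scale0r. Qed.

Lemma appZl u c f : app (c *: u) f = c *: app u f. Proof. by []. Qed.

End Action.

(** * Closure properties and induction for linear spans *)

Section Span.
Variables (K : fieldType) (V : lmodType K).
Implicit Types (S : set V).

Lemma sub_lspan S v : S v -> lspan S v.
Proof.
by exists [:: (1, v)]; split=> [x|]; rewrite ?inE ?big_seq1 ?scale1r // => /eqP->.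
Qed.

Lemma lspan_linear S c u v : lspan S u -> lspan S v -> lspan S (c *: u + v).
Proof.
move=> [s [hs ->]] [t [ht ->]]; exists ([seq (c * x.1, x.2) | x <- s] ++ t).
split=> [x|]; first by rewrite mem_cat => /orP[/mapP[y /hs Sy ->]|/ht].
rewrite big_cat big_map scaler_sumr; congr (_ + _).
by apply: eq_bigr => x _; rewrite scalerA.
Qed.

Lemma lspan0 S : lspan S 0.
Proof. by exists [::]; rewrite big_nil. Qed.

Lemma lspan_sum (I : Type) (r : seq I) (P : pred I) S (F : I -> V) :
  (forall i, P i -> lspan S (F i)) -> lspan S (\sum_(i <- r | P i) F i).
Proof.
move=> SF; apply: (big_ind (lspan S)) => //; first exact: lspan0.
by move=> u v Su Sv; rewrite -[u]scale1r; apply: lspan_linear.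
Qed.

Lemma lspan_scale S c u : lspan S u -> lspan S (c *: u).
Proof. by rewrite -[c *: u]addr0 => Su; apply: lspan_linear Su (lspan0 S). Qed.

Lemma lspan_ind S (P : V -> Prop) :
    P 0 -> (forall c u v, P u -> P v -> P (c *: u + v)) ->
    (forall v, S v -> P v) ->
  forall v, lspan S v -> P v.
Proof.
move=> P0 PD PS _ [s [hs ->]]; elim: s hs => [|x s IHs] hs.
  by rewrite big_nil.
rewrite big_cons; apply: PD; first by apply/PS/hs; rewrite mem_head.
by apply: IHs => y ys; apply: hs; rewrite inE ys orbT.
Qed.

End Span.

(** * The canonical filtration under right multiplication by monomials *)

Section Filtration.
Variables (n : nat) (K : fieldType).
Local Notation F := (@canonical_filtration n K).

Lemma filtrationS i j u : (i <= j)%N -> F i u -> F j u.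
Proof.
move=> ij; move: u; apply: (lspan_ind (P := F j)) => [|c u' v|v [a [b [ab ->]]]].
- exact: lspan0.
- exact: lspan_linear.
by apply: sub_lspan; exists a, b; rewrite (leq_trans ab).
Qed.

Lemma filtration_mulX i j u : F i u -> F i.+1 (u * Dx K U_(j)).
Proof.
move: u; apply: (lspan_ind (P := fun u => F i.+1 (u * _)))
  => [|c u v|v [a [b [ab ->]]]].
- by rewrite mul0r; apply: lspan0.
- by rewrite mulrDl -scalerAl; apply: lspan_linear.
rewrite -mulrA Ddivm_mulX mulrDr mulrA -DxD -[X in X + _]scale1r.
apply: lspan_linear.
  apply: sub_lspan; exists (a + U_(j))%MM, b; rewrite mdegD mdeg1.
  by split=> //; lia.
case: eqP => _; first by rewrite mulr0; apply: lspan0.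
apply: sub_lspan; exists a, (b - U_(j))%MM; split=> //.
by have := mdegB b U_(j); lia.
Qed.

(** This bounds the degree of operators such as x^b D x^c, which are not in normal form; the
    variables of x^c are absorbed one at a time. *)
Lemma filtration_mulDx i c u : F i u -> F (i + mdeg c) (u * Dx K c).
Proof.
move: {2 3}(mdeg c) (erefl (mdeg c)) => k.
elim: k c i u => [|k IHk] c i u ck Fu.
  by move/eqP: ck; rewrite mdeg_eq0 => /eqP ->; rewrite Dx0 mulr1 addn0.
have [j cj] : exists j, c j != 0%N.
  apply/existsP; apply: contra_eqT ck => /existsPn c0.
  by rewrite mdegE big1 // => j _; apply/eqP/negbNE/c0.
have ec : c = (U_(j) + (c - U_(j)))%MM.
  apply/mnmP => l; rewrite mnmDE mnmBE mnm1E.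
  by case: (eqVneq j l) cj => [<-|_]; lia.
have ek : mdeg (c - U_(j)) = k.
  by move: ck; rewrite {1}ec mdegD mdeg1; lia.
by rewrite ec DxD mulrA addnS -addSn; apply: IHk ek (filtration_mulX j Fu).
Qed.

Lemma filtration_fin_dim i : fin_dim (F i).
Proof.
pose B : finType := 'X_{1..n < i.+1}.
exists [seq Dx K (ab.1 : B) * Ddivm K (ab.2 : B) |
  ab <- [seq ab <- enum {: B * B} | mdeg (ab.1 : B) + mdeg (ab.2 : B) <= i]%N].
congr lspan; apply/seteqP; split=> u.
  move=> [a [b [ab ->]]]; have ai : (mdeg a < i.+1)%N by lia.
  have bi : (mdeg b < i.+1)%N by lia.
  apply/mapP; exists (BMultinom ai, BMultinom bi) => //.
  by rewrite mem_filter /= ab mem_enum.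
move=> /mapP[[a b]]; rewrite mem_filter => /andP[ab _] ->.
by exists a, b.
Qed.

End Filtration.

(** * Products of finite-dimensional subspaces *)

Section Smul.
Variables (K : fieldType) (A : algType K) (M : lmodType A).
Local Notation MK := (restrict_scalars M).

Lemma rscaleE (c : K) (m : MK) : c *: m = (c%:A : A) *: (m : M).
Proof. by []. Qed.

Lemma rscaleAl (c : K) (a : A) (m : M) :
  (c *: (a *: m : MK) : M) = (c *: a) *: m.
Proof. by rewrite rscaleE scalerA -scalerAl mul1r. Qed.

Lemma rscaleAr (c : K) (a : A) (m : MK) :
  (a *: (c *: m : M) : M) = (c *: a) *: (m : M).
Proof. by rewrite rscaleE scalerA -scalerAr mulr1. Qed.

(** By bilinearity, the pairwise products of two finite spanning families span the product. *)
Lemma smul_fin_dim (B : set A) (C : set MK) :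
  fin_dim B -> fin_dim C -> fin_dim (smul B C).
Proof.
move=> [s ->] [t ->].
exists [seq (u *: (v : M) : MK) | u <- s, v <- t].
apply/seteqP; split=> m.
  move=> [r [hr ->]]; rewrite big_seq; apply: (lspan_sum (V := MK)) => x /hr[].
  move: (x.1) (x.2) => u v hu hv; move: u hu.
  apply: (lspan_ind (P := fun u => lspan _ (u *: v : MK)))
    => [|c u u' hu hu'|u su].
  - by rewrite scale0r; apply: lspan0.
  - by rewrite scalerDl -rscaleAl; apply: lspan_linear.
  move: v hv; apply: (lspan_ind (V := MK) (P := fun v => lspan _ (u *: (v : M) : MK)))
    => [|c v v' hv hv'|v tv].
  - by rewrite scaler0; apply: lspan0.
  - by rewrite scalerDr rscaleAr -rscaleAl; apply: lspan_linear.
  by apply: sub_lspan; apply/allpairsP; exists (u, v).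
move=> [r [hr ->]]; elim: r hr => [|x r IHr] hr.
  by exists [::]; rewrite !big_nil.
have [y [hy ey]] := IHr (fun y yr => hr y (@mem_behead _ (x :: r) y yr)).
have /allpairsP[[u v] [/= us vt xe]] := hr x (mem_head _ _).
(* A sum in [smul] carries no coefficients, so the scalar is absorbed into the factor from [B]. *)
exists ((x.1 *: u, v) :: y); split=> [z|]; last first.
  by rewrite !big_cons ey /= -rscaleAl -xe.
rewrite inE => /predU1P[->|/hy //]; split; last exact: sub_lspan.
exact/lspan_scale/sub_lspan.
Qed.

End Smul.

(** * Matrix units in the ring of differential operators *)

Section MatrixUnits.
Variables (n : nat) (K : fieldType) (p k : nat).
Hypothesis pK : p \in [pchar K].
Local Notation q := (p ^ k)%N.
Local Notation app u := (endo_app (diffop_val u)).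
Local Notation box := {ffun 'I_n -> 'I_q}.
Implicit Types (a b : box) (m : 'X_{1..n}).

Let q_gt0 : (0 < q)%N.
Proof. by rewrite expn_gt0 prime_gt0 // (pcharf_prime pK). Qed.

Definition top_mnm : 'X_{1..n} := [multinom q.-1 | i < n].
Definition low_mnm a : 'X_{1..n} := [multinom a i : nat | i < n].
(** Multiplication by this monomial moves x^a to the top corner of the box, the only monomial of the
    box that D does not kill. *)
Definition colow_mnm a : 'X_{1..n} := [multinom (q.-1 - a i)%N | i < n].

Local Notation D := (Ddivm K top_mnm).

Lemma app_Ddivm_top m :
  app D 'X_[m] = [forall i, (q %| (m i).+1)%N]%:R *: 'X_[m - top_mnm].
Proof.
rewrite app_Ddivm natr_prod; congr (_ *: _).
under eq_bigr => i _ do rewrite mnmE bin_predn_pchar //.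
case: (boolP [forall i, _]) => [/forallP qm|/forallPn[i qi]].
  by rewrite big1 // => i _; rewrite qm.
by rewrite (bigD1 i) //= (negPf qi) mul0r.
Qed.

(* E(a, b) := x^a D x^(q-1-b), for a, b in the box, is linear over the q-th
   powers, sends x^b to x^a and kills the other monomials of the box. The
   relations between these matrix units follow from the next two lemmas. *)
Lemma sum_matrix_units :
  \sum_a Dx K (low_mnm a) * (D * Dx K (colow_mnm a)) = 1.
Proof.
apply: diffopXP => m; rewrite app_sum [RHS](_ : _ = 'X_[m]) //.
(* On x^m only the summand indexed by the residues of m modulo q survives, and it gives x^m back. *)
pose a0 : box := [ffun i => Ordinal (ltn_pmod (m i) q_gt0)].
have supp a : [forall i, (q %| ((colow_mnm a + m)%MM i).+1)%N] = (a == a0).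
  apply/forallP/eqP => [qa|-> i].
    apply/ffunP => i; apply/val_inj; rewrite ffunE /=.
    have := qa i; rewrite mnmDE mnmE.
    have : (a i < q)%N by [].
    move: (a i : nat) (m i) q_gt0 => x y; move: q => Q *.
    (* Adding Q to y makes the difference with x a genuine subtraction. *)
    have : (y + Q = x %[mod Q])%N.
      apply/eqP; rewrite eqn_mod_dvd; last lia.
      by rewrite (_ : _ - _ = (Q.-1 - x + y).+1)%N //; lia.
    by rewrite modnDr (modn_small (m := x)).
  rewrite mnmDE mnmE ffunE /=; have := ltn_pmod (m i) q_gt0.
  rewrite {3}(divn_eq (m i) q) => lt.
  rewrite (_ : _.+1 = (m i %/ q).+1 * q)%N ?dvdn_mull //.
  by rewrite mulSn; lia.
rewrite (bigD1 a0) // big1 => [|a /andP[_ /negPf na]]; last first.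
  by rewrite !appM !app_Dx app_Ddivm_top supp na scale0r appZ0.
rewrite !appM !app_Dx app_Ddivm_top supp eqxx scale1r app_Dx [LHS]addr0.
congr 'X_[_]; apply/mnmP => i; rewrite !(mnmDE, mnmBE, mnmE) ffunE /=.
by have := ltn_pmod (m i) q_gt0; have := leq_mod (m i) q; lia.
Qed.

(** A nonzero value of the right-hand D on a monomial has all its exponents divisible by q. After
    multiplication by x^(a + q - 1 - b), the left-hand D keeps it exactly when a = b. *)
Lemma matrix_units_orthogonal a b :
  D * Dx K (colow_mnm b) * (Dx K (low_mnm a) * D) = (a == b)%:R *: D.
Proof.
apply: diffopXP => m; rewrite appZl !appM app_Ddivm_top !appZ !app_Dx.
rewrite app_Ddivm_top.
case: (boolP [forall i, _]) => [/forallP qm|_]; last by rewrite !scale0r scaler0.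
rewrite !scale1r.
have qm' i : ((m - top_mnm)%MM i + q = (m i).+1)%N.
  by rewrite mnmBE mnmE; have := dvdn_leq _ (qm i); lia.
have -> : [forall i,
    (q %| ((colow_mnm b + (low_mnm a + (m - top_mnm)))%MM i).+1)%N] = (a == b).
  apply/forallP/eqP => [qab|-> i].
    apply/ffunP => i; apply/val_inj => /=; move: (qab i) (qm i).
    rewrite 2!mnmDE -qm' !mnmE; set t := (m i - _)%N.
    have : (a i < q)%N by []. have : (b i < q)%N by [].
    move: (a i : nat) (b i : nat) q_gt0 t => x y; move: q => Q Q_gt0 t ltx lty.
    rewrite dvdn_addl // => qs qt.
    have : (x + Q = y %[mod Q])%N.
      apply/eqP; rewrite eqn_mod_dvd; last lia.
      rewrite -(dvdn_addl _ qt).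
      by rewrite (_ : _ + t = (Q.-1 - y + (x + t)).+1)%N //; lia.
    by rewrite modnDr !modn_small.
  rewrite 2!mnmDE; have := qm i; rewrite -qm' !mnmE; set t := (m i - _)%N.
  by rewrite (_ : _.+1 = t + q)%N //; have := ltn_ord (b i); lia.
have [->|] := eqVneq a b; last by rewrite !scale0r.
rewrite !scale1r; congr 'X_[_]; apply/mnmP => i; have := qm' i.
by rewrite !(mnmDE, mnmBE, mnmE); have := ltn_ord (b i); lia.
Qed.

Lemma mdeg_le_box m : (forall i, (m i <= q)%N) -> (mdeg m <= n * q)%N.
Proof.
move=> mq; rewrite mdegE -[n in leqRHS]card_ord -sum_nat_const.
by apply: leq_sum => i _.
Qed.

Lemma ldim_filtration_ge (M : lmodType (diffop n K))
    (M0 : set (restrict_scalars M)) :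
    fin_dim M0 -> smul setT M0 = setT -> (exists m : M, m != 0) ->
  (q ^ n <= ldim (smul (@canonical_filtration n K (3 * n * q)) M0))%N.
Proof.
move=> M0_fd M0_gen [m m_neq0].
have [v M0v v_neq0] : exists2 v : M, M0 v & v != 0.
  apply: contrapT => noM0; have : smul setT M0 m by rewrite M0_gen.
  move=> [s [hs em]]; move/eqP: m_neq0; apply.
  rewrite em big_seq big1 // => x xs.
  apply: contrapT => x_neq0; apply: noM0; exists x.2; first by have [] := hs x xs.
  by apply/eqP => x0; apply: x_neq0; rewrite x0 scaler0.
(* Otherwise every term of [sum_matrix_units] would kill v, and so would 1. *)
have [a a_neq0] : exists a : box, (D * Dx K (colow_mnm a)) *: v != 0.
  apply: contrapT => noa; move/eqP: v_neq0; apply.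
  rewrite -[v]scale1r -sum_matrix_units scaler_suml big1 // => a _.
  apply: contrapT => a_neq0; apply: noa; exists a.
  by apply/eqP => a0; apply: a_neq0; rewrite -scalerA a0 scaler0.
pose w (b : box) : restrict_scalars M :=
  (Dx K (low_mnm b) * (D * Dx K (colow_mnm a))) *: v.
have -> : (q ^ n = #|{: box}|)%N by rewrite card_ffun !card_ord.
apply: (card_free_le_ldim (w := w)).
- by apply: smul_fin_dim => //; exact: filtration_fin_dim.
- move=> b; exists [:: (Dx K (low_mnm b) * (D * Dx K (colow_mnm a)), v)].
  split=> [x|]; last by rewrite big_seq1.
  rewrite inE => /eqP -> /=; split=> //.
  (* The constant 3 counts three monomials of degree at most nq: x^b and the order of D give 2nq,
     and the right factor x^(q-1-a) gives the rest. *)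
  apply: (@filtrationS _ _ (2 * n * q + mdeg (colow_mnm a))).
    have : (mdeg (colow_mnm a) <= n * q)%N.
      by apply: mdeg_le_box => i; rewrite mnmE; have := leq_pred q; lia.
    by rewrite -!mulnA; lia.
  rewrite mulrA; apply: filtration_mulDx; apply: sub_lspan.
  exists (low_mnm b), top_mnm; split=> //.
  rewrite -mulnA mul2n -addnn leq_add //; apply: mdeg_le_box => i; rewrite mnmE.
    exact: ltnW.
  exact: leq_pred.
move=> c c0 b; apply/eqP; apply: contraNT a_neq0 => cb.
(* Applied to a linear relation between the [w b'], this operator isolates the coefficient [c b] in
   front of a nonzero vector. *)
have actD b' : (D * Dx K (colow_mnm b)) *: (c b' *: w b' : M) =
    (c b' * (b' == b)%:R) *: ((D * Dx K (colow_mnm a)) *: v : restrict_scalars M).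
  rewrite rscaleAr scalerA -scalerAl !rscaleAl -scalerA; congr (_ *: _ *: _).
  by rewrite scalerAl -matrix_units_orthogonal !mulrA.
have := congr1 (fun x : M => (D * Dx K (colow_mnm b)) *: x) c0.
rewrite scaler0 scaler_sumr (eq_bigr _ (fun b' _ => actD b')) (bigD1 b) //=.
rewrite eqxx mulr1 big1 ?addr0 => [|b' /negPf ->]; last by rewrite mulr0 scale0r.
by move/eqP; rewrite (@scaler_eq0 K (restrict_scalars M)) (negPf cb).
Qed.

End MatrixUnits.

(** * Comparison of growth rates along the indices 3nq *)

Theorem theorem1p4 (R : realType) (K : fieldType) (p : nat) (n : nat)
    (hp : p \in [pchar K]) (hn : (1 <= n)%N)
    (M : lmodType (diffop n K))
    (M_fg : finitely_generated M) (M_nz : exists m : M, m != 0)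
    (d : \bar R) (hd : is_Dim M d) :
  (n%:R%:E <= d)%E.
Proof.
have [M0 [M0_fd M0_gen ->]] := hd.
(* It suffices to bound each admissible exponent r; if there is none, the infimum is [+oo]. *)
apply: le_ereal_inf_tmp => _ [r [r_ge0 [N _ dimN]] <-]; rewrite lee_fin leNgt.
apply/negP => r_lt_n.
have p_gt1 : (1 < p)%N by exact: prime_gt1 (pcharf_prime hp).
have s_gt0 : 0 < n%:R - r by rewrite subr_gt0.
pose C : R := (3 * n)%:R `^ r.
(* Since q = p^k > k, the first bound puts 3nq in the range where [dimN] applies. The second forces
   q^(n-r) > C, contradicting q^n <= (3nq)^r = C q^r. *)
pose k := (maxn N (Num.trunc (C `^ (n%:R - r)^-1)).+1)%N.
pose q := (p ^ k)%N; have q_gt_k : (k < q)%N by exact: ltn_expl.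
have q_gt0 : 0 < q%:R :> R by rewrite ltr0n (leq_ltn_trans _ q_gt_k).
have C_lt_q : C < q%:R `^ (n%:R - r).
  have <- : C `^ (n%:R - r)^-1 `^ (n%:R - r) = C.
    by rewrite -powRrM mulVf ?lt0r_neq0 // powRr1 // powR_ge0.
  apply: gt0_ltr_powR; rewrite ?nnegrE ?powR_ge0 ?ltW //.
  apply: lt_le_trans (truncnS_gt _) _; rewrite ler_nat.
  by apply: leq_trans (ltnW q_gt_k); exact: leq_maxr.
have qn : q%:R `^ n%:R <= C * q%:R `^ r.
  rewrite -powRM ?ler0n // -natrM powR_mulrn ?ler0n // -natrX.
  apply: le_trans (dimN (3 * n * q)%N _).
    by rewrite ler_nat; apply: (ldim_filtration_ge k hp).
  rewrite /=; apply: leq_trans (leq_maxl N _) _; apply: leq_trans (ltnW q_gt_k) _.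
  by rewrite leq_pmull // muln_gt0.
move: C_lt_q; rewrite ltNge => /negP; apply.
rewrite powRB ?lt0r_neq0 ?implybT // ler_pdivrMr //.
by rewrite powR_gt0.
Qed.
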